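(* Let $u_k\in W$ and let $u_{k+1/2}\in W$ be related to $u_k$ by $$t(u_{k+1/2},v)=s(u_k,v)+\ell(v)\qquad\text{for all } v\in W.$$ Let $r_k:=\mathcal R(u_k)$ and $r_{k+1/2}:=\mathcal R(u_{k+1/2})$ be the preconditioned residuals. Then $$\|r_{k+1/2}\|_{\sigma_t}\le \rho\,\|r_k\|_{\sigma_t}.$$
   Context: Setting. Let $R\subset\mathbb R^d$ be a domain with Lipschitz boundary and outward unit normal $\mathbf n(\mathbf r)$, $S^{d-1}$ the unit sphere, $D:=R\times S^{d-1}$, $\partial D:=\partial R\times S^{d-1}$ and $\partial D_-:=\{(\mathbf r,\mathbf s)\in\partial R\times S^{d-1}:\mathbf n(\mathbf r)\cdot\mathbf s<0\}$. The gradient $\nabla$ acts in $\mathbf r$ only. Data. $\sigma_s,\sigma_t:R\to\mathbb R$ are positive and essentially bounded, $\sigma_t=\sigma_a+\sigma_s$, and there is $c_0>0$ with $\sigma_a\ge c_0$ a.e. in $R$; $\rho:=\|\sigma_s/\sigma_t\|_\infty<1$. The phase function $\theta:[-1,1]\to\mathbb R$ is non-negative with $\int_{S^{d-1}}\theta(\mathbf s\cdot\mathbf s')\,d\mathbf s'=1$ for a.e. $\mathbf s$. Sources: $q\in L^2(D)$ and $q_\partial\in L^2(\partial D_-;|\mathbf s\cdot\mathbf n|)$. Put $(\mathcal S v)(\mathbf r,\mathbf s):=\sigma_s(\mathbf r)\int_{S^{d-1}}\theta(\mathbf s\cdot\mathbf s')v(\mathbf r,\mathbf s')\,d\mathbf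 s'$ for $v\in L^2(D)$. Spaces. $V_0:=L^2(D)$ with inner product $(\cdot,\cdot)$; $V_1:=\{v\in V_0:\mathbf s\cdot\nabla v\in V_0,\ v|_{\partial D_-}\in L^2(\partial D_-;|\mathbf s\cdot\mathbf n|)\}$, the completion of $C^\infty(\overline D)$ under the norm induced by $(v,w)+(\mathbf s\cdot\nabla v,\mathbf s\cdot\nabla w)+\int_{\partial D_-}|\mathbf s\cdot\mathbf n|\,v\,w$. Even/odd parts: $v^\pm(\mathbf r,\mathbf s):=\tfrac12(v(\mathbf r,\mathbf s)\pm v(\mathbf r,-\mathbf s))$; $V^\pm:=\{v^\pm:v\in V\}$. $W:=V_1^+\oplus V_0^-$. Weighted norm: $\|v\|_{\sigma_t}:=\|\sqrt{\sigma_t}\,v\|_{L^2(D)}$. Forms on $W$: $t(u,v):=(\mathbf s\cdot\nabla u^+,v^-)-(u^-,\mathbf s\cdot\nabla v^+)+(\sigma_t u,v)+\int_{\partial D}|\mathbf s\cdot\mathbf n|\,u^+v^+$, $\ s(u,v):=(\mathcal S u,v)$, $\ \ell(v):=(q,v)-2\int_{\partial D_-}\mathbf s\cdot\mathbf n\,q_\partial\,v^+$. Preconditioned residual operator $\mathcal R:W\to W$: $\mathcal R(w)$ is the unique element of $W$ with $t(\mathcal R(w),v)=\ell(v)-t(w,v)+s(w,v)$ for all $v\in W$. *)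

(* Defs.v *)
From HB Require Import structures.
From mathcomp Require Import all_boot all_order all_algebra.
From mathcomp Require Import all_classical all_reals all_analysis measurable_realfun.

Set Implicit Arguments.
Unset Strict Implicit.
Unset Printing Implicit Defensive.

Import Order.TTheory GRing.Theory Num.Theory.
Import numFieldNormedType.Exports.

Local Open Scope classical_set_scope.
Local Open Scope ring_scope.

(* The library's norm on row vectors is the sup norm. It is used below only
   for the topology, for derivatives and for Lipschitz continuity, none of
   which depends on the choice of the norm; lengths use enorm. *)
Definition edot {R : realType} {n} (x y : 'rV[R]_n) : R :=
  \sum_(i < n) x 0 i * y 0 i.

Definition enorm {R : realType} {n} (x : 'rV[R]_n) : R := Num.sqrt (edot x x).

Definition usphere {R : realType} {n} : set 'rV[R]_n := [set s | enorm s = 1].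

Definition uball {R : realType} {n} : set 'rV[R]_n := [set x | enorm x <= 1].

Definition bd {T : topologicalType} (A : set T) : set T :=
  closure A `\` interior A.

(* 'rV[R]_n carries the sigma-algebra generated by the coordinates, which is
   its Borel sigma-algebra. *)
Definition rV_display : measure_display.
Proof. exact: default_measure_display. Qed.

Section rV_measurable.
Context {R : realType} (n : nat).

Definition rV_coord (i : 'I_n) (x : 'rV[R]_n) : R := x 0 i.

Let rV_set0 : g_sigma_preimage rV_coord set0.
Proof. exact: sigma_algebra0. Qed.

Let rV_setC A : g_sigma_preimage rV_coord A -> g_sigma_preimage rV_coord (~` A).
Proof. exact: sigma_algebraC. Qed.

Let rV_bigcup (F : (set 'rV[R]_n)^nat) :
  (forall i, g_sigma_preimage rV_coord (F i)) ->
  g_sigma_preimage rV_coord (\bigcup_i F i).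
Proof. exact: sigma_algebra_bigcup. Qed.

HB.instance Definition _ := @isMeasurable.Build rV_display 'rV[R]_n
  (g_sigma_preimage rV_coord) rV_set0 rV_setC rV_bigcup.

Lemma measurable_rV_coord (i : 'I_n) : measurable_fun [set: 'rV[R]_n] (rV_coord i).
Proof.
move=> _ Y mY; rewrite setTI; apply: sub_sigma_algebra => /=.
rewrite -bigcup_seq/=; exists i => /=; first by rewrite mem_index_enum.
by exists Y => //; rewrite setTI.
Qed.

End rV_measurable.

Lemma measurable_fun_rVP {R : realType} n d (T : measurableType d)
    (f : T -> 'rV[R]_n) :
  measurable_fun [set: T] f <->
  forall i, measurable_fun [set: T] (fun t => f t 0 i).
Proof.
split=> [mf i|mf].
  exact: (measurableT_comp (@measurable_rV_coord R n i) mf).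
move=> _ A mA; rewrite setTI.
suff : g_sigma_preimage (@rV_coord R n) `<=` [set B | measurable (f @^-1` B)].
  exact.
apply: smallest_sub.
  split => [|B mB|F mF] /=.
  - by rewrite preimage_set0.
  - by rewrite setTD preimage_setC; exact: measurableC.
  - by rewrite preimage_bigcup; exact: bigcupT_measurable.
rewrite -bigcup_seq/=; apply: bigcup_sub => i _ B [C mC <-] /=.
rewrite setTI -[X in measurable X]setTI.
exact: mf.
Qed.

(* The library's canonical instance cannot be inferred, as it depends on mf. *)
Definition pushmeasure d1 d2 (T1 : measurableType d1) (T2 : measurableType d2)
    {R : realType} (mu : {measure set T1 -> \bar R}) (f : T1 -> T2)
    (mf : measurable_fun [set: T1] f) : {measure set T2 -> \bar R} :=
  measure_function_pushforward__canonical__measure_function_Measure mu mf.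

Section lebesgue_rV.
Context {R : realType}.

Definition rV_snoc n (x : 'rV[R]_n * R) : 'rV[R]_n.+1 :=
  \row_(i < n.+1) if unlift ord_max i is Some j then x.1 0 j else x.2.

Lemma measurable_rV_snoc n :
  measurable_fun [set: 'rV[R]_n * measurableTypeR R] (@rV_snoc n).
Proof.
apply/measurable_fun_rVP => i.
have [j|] := unliftP ord_max i; move=> E.
  rewrite (_ : (fun _ => _) = @rV_coord R n j \o fst); last first.
    by apply/funext => x; rewrite /rV_snoc mxE E liftK.
  exact: (measurableT_comp (@measurable_rV_coord R n j) measurable_fst).
rewrite (_ : (fun _ => _) = snd); last first.
  by apply/funext => x; rewrite /rV_snoc mxE E unlift_none.
exact: measurable_snd.
Qed.

(* Lebesgue measure on R^n *)
Fixpoint leb n : {measure set 'rV[R]_n -> \bar R} :=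
  match n with
  | 0 => dirac (0 : 'rV[R]_0)
  | m.+1 => pushmeasure (leb m \x lebesgue_measure)%E (@measurable_rV_snoc m)
  end.

End lebesgue_rV.

Section sphere_measure.
Context {R : realType} (n : nat).

Lemma measurable_edot : measurable_fun [set: 'rV[R]_n] (fun x => edot x x).
Proof.
apply: measurable_sum => i.
by apply: measurable_funM; exact: measurable_rV_coord.
Qed.

Lemma measurable_enorm : measurable_fun [set: 'rV[R]_n] (@enorm R n).
Proof.
apply: (measurableT_comp (f := @Num.sqrt R)); last exact: measurable_edot.
apply: continuous_measurable_fun; exact: sqrt_continuous.
Qed.

Lemma measurable_uball : measurable (@uball R n).
Proof.
rewrite (_ : uball = @enorm R n @^-1` `]-oo, 1]); last first.
  by apply/seteqP; split => x; rewrite /= in_itv.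
rewrite -[X in measurable X]setTI; exact: measurable_enorm.
Qed.

Definition normalize (x : 'rV[R]_n) : 'rV[R]_n := (enorm x)^-1 *: x.

Lemma measurable_normalize : measurable_fun [set: 'rV[R]_n] normalize.
Proof.
apply/measurable_fun_rVP => i.
rewrite (_ : (fun _ => _) = (fun x => enorm x `^ (-1)) \* rV_coord i).
  apply: measurable_funM; last exact: measurable_rV_coord.
  exact: (measurableT_comp (measurable_powR _)) measurable_enorm.
by apply/funext => x; rewrite mxE /= powR_inv1// sqrtr_ge0.
Qed.

(* Surface measure of the unit sphere, as a measure on R^n: the measure of a
   subset A of the sphere is n times the volume of { t s | 0 < t <= 1, s in A }.
   For n = 1 it is the counting measure of {-1, 1}. *)
Definition sphere_measure : set 'rV[R]_n -> \bar R :=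
  mscale (NngNum (ler0n R n))
    (pushmeasure (mrestr (leb n) measurable_uball) measurable_normalize).

HB.instance Definition _ := Measure.on sphere_measure.

End sphere_measure.

Section sphere_measure_finite.
Context {R : realType}.

Let cube n : set 'rV[R]_n := [set x | forall i, x 0 i \in `[-1, 1]].

Let measurable_cube n : measurable (@cube n).
Proof.
rewrite (_ : @cube n = \bigcap_(i in [set: 'I_n]) (@rV_coord R n i @^-1` `[-1, 1])).
  apply: fin_bigcap_measurable => // i _.
  by rewrite -[X in measurable X]setTI; exact: measurable_rV_coord.
by apply/seteqP; split => x /= xP i; [move=> _; exact: xP|exact: (xP i I)].
Qed.

Let leb_cube n : (leb n (@cube n) < +oo)%E.
Proof.
elim: n => [|n IH]; first by rewrite /= diracE ltry.
rewrite /= /pushforward (_ : _ @^-1` _ = @cube n `*` `[-1, 1]).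
  have I2 : (lebesgue_measure (`[(-1)%R, 1%R] : set R) < +oo)%E.
    by rewrite lebesgue_measure_itv /=; case: ifPn => _; rewrite ltry.
  rewrite product_measure1E//=; last exact: measurable_cube.
  by rewrite lte_mul_pinfty ?ge0_fin_numE ?measure_ge0.
apply/seteqP; split => [x xP|x [x1 x2] i] /=.
  split=> [i|].
    by have := xP (lift ord_max i); rewrite mxE liftK.
  by have := xP ord_max; rewrite mxE unlift_none.
by rewrite mxE; case: unliftP => [j _|_]; [exact: x1|exact: x2].
Qed.

Let uball_cube n : @uball R n `<=` @cube n.
Proof.
move=> x; rewrite /uball /= /enorm => x1 i.
have e0 : 0 <= edot x x by apply: sumr_ge0 => j _; rewrite -expr2 sqr_ge0.
have : edot x x <= 1.
  by rewrite -(sqr_sqrtr e0) -[leRHS](expr1n _ 2) lerXn2r ?nnegrE ?sqrtr_ge0.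
rewrite /edot (bigD1 i)//= => h.
have {h} : x 0 i * x 0 i <= 1.
  apply: le_trans h; rewrite lerDl; apply: sumr_ge0 => j _.
  by rewrite -expr2 sqr_ge0.
by rewrite in_itv/= -ler_norml -expr2 -real_normK ?num_real// expr_le1.
Qed.

Let sphere_measure_lty n : (@sphere_measure R n setT < +oo)%E.
Proof.
rewrite /sphere_measure /= /mscale /= /pushforward preimage_setT /mrestr setTI.
apply: lte_mul_pinfty; rewrite ?lee_fin//.
apply: le_lt_trans (leb_cube n).
by apply: le_measure; rewrite ?inE; [exact: measurable_uball|exact: measurable_cube|exact: uball_cube].
Qed.

HB.instance Definition _ n := Measure_isFinite.Build _ _ _
  (@sphere_measure R n) (lty_fin_num_fun (sphere_measure_lty n)).
End sphere_measure_finite.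
Arguments sphere_measure {R} n _.

Section hausdorff_measure.
Context {R : realType} {n : nat}.
Implicit Types A : set 'rV[R]_n.
Local Open Scope ereal_scope.

Definition ediam A : \bar R :=
  ereal_sup [set (enorm (x - y))%:E | x in A & y in A].

(* The size of A in a cover of mesh at most delta for the k-dimensional
   Hausdorff measure: vol (uball of R^k) * (diam A / 2) ^ k. *)
Definition hgauge k (delta : R) A : \bar R :=
  if A == set0 then 0 else
  if ediam A <= delta%:E then
    leb k (@uball R k) * ((fine (ediam A) / 2) ^+ k)%:E
  else +oo.

Definition hausdorff_delta k (delta : R) A : \bar R :=
  ereal_inf [set \sum_(j <oo) hgauge k delta (F j) |
             F in [set F : (set 'rV[R]_n)^nat | A `<=` \bigcup_j F j]].

(* normalized so that hausdorff n is Lebesgue (outer) measure on R^n *)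
Definition hausdorff k A : \bar R :=
  ereal_sup [set hausdorff_delta k delta A | delta in [set x : R | (0 < x)%R]].

Let enorm_ge0 (x : 'rV[R]_n) : (0 <= enorm x)%R. Proof. exact: sqrtr_ge0. Qed.

Lemma hgauge_ge0 k delta A : 0 <= hgauge k delta A.
Proof.
rewrite /hgauge; case: ifPn => A0; first by [].
have [a Aa] : A !=set0 by exact/set0P.
case: ifPn => // _.
rewrite mule_ge0// lee_fin exprn_ge0// divr_ge0// fine_ge0//.
apply: (@le_trans _ _ (enorm (a - a))%:E); first by rewrite lee_fin.
by apply: ereal_sup_ubound; exists a => //; exists a.
Qed.

Lemma hgauge0 k delta : hgauge k delta set0 = 0.
Proof. by rewrite /hgauge eqxx. Qed.

Let discr : measurableType _ := g_sigma_algebraType [set: set 'rV[R]_n].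

Let hausdorff_deltaE k delta :
  hausdorff_delta k delta = @mu_ext _ discr R (hgauge k delta).
Proof.
apply/funext => A; congr ereal_inf; apply/seteqP; split => x [F].
  move=> AF <-; exists F => //; split => // i.
  exact: sub_sigma_algebra.
by move=> [_ AF] <-; exists F.
Qed.

Lemma hausdorff_delta_ge0 k delta A : 0 <= hausdorff_delta k delta A.
Proof. by rewrite hausdorff_deltaE; apply: mu_ext_ge0 => *; exact: hgauge_ge0. Qed.

Lemma hausdorff_ge0 k A : 0 <= hausdorff k A.
Proof.
apply: (@le_trans _ _ (hausdorff_delta k 1 A)).
  exact: hausdorff_delta_ge0.
by apply: ereal_sup_ubound; exists 1%R => //=.
Qed.

Lemma hausdorff0 k : hausdorff k set0 = 0.
Proof.
apply/eqP; rewrite eq_le hausdorff_ge0 andbT.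
apply: ge_ereal_sup => _ [delta _ <-]; rewrite hausdorff_deltaE mu_ext0//.
  exact: hgauge0.
by move=> *; exact: hgauge_ge0.
Qed.

Lemma le_hausdorff k : {homo hausdorff k : A B / A `<=` B >-> A <= B}.
Proof.
move=> A B AB; apply: ge_ereal_sup => _ [delta d0 <-].
apply: (@le_trans _ _ (hausdorff_delta k delta B)).
  by rewrite hausdorff_deltaE; exact: le_mu_ext.
by apply: ereal_sup_ubound; exists delta.
Qed.

Lemma hausdorff_sigma_subadditive k : sigma_subadditive (hausdorff k).
Proof.
move=> F; apply: ge_ereal_sup => _ [delta d0 <-].
apply: (@le_trans _ _ (\sum_(i <oo) hausdorff_delta k delta (F i))).
  rewrite hausdorff_deltaE; apply: mu_ext_sigma_subadditive.
  by move=> *; exact: hgauge_ge0.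
apply: lee_nneseries => [i _ _|i _]; first exact: hausdorff_delta_ge0.
by apply: ereal_sup_ubound; exists delta.
Qed.

End hausdorff_measure.

Section surface_measure.
Context {R : realType} {d : nat} (Om : set 'rV[R]_d).

(* (d-1)-dimensional Hausdorff measure restricted to the boundary of Om *)
Definition surface_outer (A : set 'rV[R]_d) : \bar R :=
  hausdorff d.-1 (A `&` bd Om).

Let surface_outer0 : surface_outer set0 = 0%E.
Proof. by rewrite /surface_outer set0I hausdorff0. Qed.

Let surface_outer_ge0 A : (0 <= surface_outer A)%E.
Proof. exact: hausdorff_ge0. Qed.

Let le_surface_outer :
  {homo surface_outer : A B / A `<=` B >-> (A <= B)%E}.
Proof. by move=> A B AB; apply: le_hausdorff; exact: setSI. Qed.

Let surface_outer_sigma_subadditive : sigma_subadditive surface_outer.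
Proof.
by move=> F; rewrite /surface_outer setI_bigcupl; exact: hausdorff_sigma_subadditive.
Qed.

HB.instance Definition _ := isOuterMeasure.Build R 'rV[R]_d surface_outer
  surface_outer0 surface_outer_ge0 le_surface_outer
  surface_outer_sigma_subadditive.

Let so : {outer_measure set 'rV[R]_d -> \bar R} := surface_outer.

(* R^d with the sigma-algebra of the Caratheodory-measurable sets of
   surface_outer *)
Definition surface_type := caratheodory_type so.
HB.instance Definition _ := Measurable.on surface_type.

Definition surface_measure : {measure set surface_type -> \bar R} :=
  (so : set (caratheodory_type so) -> \bar R)
    : {measure set (caratheodory_type so) -> \bar R}.

End surface_measure.

Section domain.
Context {R : realType} {d : nat}.
Local Notation X := 'rV[R]_d.
Implicit Types (Om : set X) (nu : X -> X).

Definition domain Om := [/\ open Om, connected Om & Om !=set0].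

(* Near each boundary point, Om is the part of R^d lying above the graph of a
   Lipschitz function over a hyperplane; e is the unit normal of the hyperplane
   and x - (x . e) e is the projection of x onto it. *)
Definition lipschitz_boundary Om := forall x0, bd Om x0 ->
  exists (e : X) (g : X -> R) (L : R),
    [/\ enorm e = 1, L.-lipschitz g &
        \forall x \near x0, Om x <-> g (x - edot x e *: e) < edot x e].

(* To first order at r, Om is the half-space of the x with (x - r) . w < 0. *)
Definition outward_normal_at Om (r w : X) :=
  enorm w = 1 /\ forall eps : R, 0 < eps -> \forall x \near r,
    (edot (x - r) w < - eps * enorm (x - r) -> Om x) /\
    (eps * enorm (x - r) < edot (x - r) w -> ~ Om x).

(* On a Lipschitz boundary the normal exists almost everywhere only, so a normal
   field is a measurable function equal to it almost everywhere. *)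
Definition outward_unit_normal Om nu :=
  measurable_fun [set: surface_type Om] (nu : surface_type Om -> X) /\
  {ae surface_measure Om, forall r, bd Om r -> outward_normal_at Om r (nu r)}.

End domain.

(* Continuous directional derivatives of all orders <= k, in all directions:
   in finite dimension this is the class C^k. *)
Fixpoint Ck {R : realType} {V : normedModType R} k (f : V -> R) : Prop :=
  match k with
  | 0 => continuous f
  | k'.+1 => continuous f /\
      forall v, (forall x, derivable f x v) /\ Ck k' (fun x => 'D_v f x)
  end.

Definition smooth {R : realType} {V : normedModType R} (f : V -> R) :=
  forall k, Ck k f.

Section phase_space.
Context {R : realType} {d : nat} (Om : set 'rV[R]_d).
Local Notation X := 'rV[R]_d.
Variable nu : X -> X.

(* A point (r, s) of D or of its boundary is a pair of vectors of R^d; functions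
   on D, on the boundary of D or on the inflow boundary are functions on X * X,
   whose values elsewhere are irrelevant. *)
Definition phase : set (X * X) := Om `*` usphere.
Definition bdD : set (X * X) := bd Om `*` usphere.

Definition sn (z : X * X) : R := edot z.2 (nu z.1).

Definition inflow : set (X * X) := [set z | bdD z /\ sn z < 0].
Definition outflow : set (X * X) := [set z | bdD z /\ 0 < sn z].

Definition volD : {measure set (X * X) -> \bar R} :=
  (leb d \x sphere_measure d)%E.

Definition volbdD : {measure set (surface_type Om * X) -> \bar R} :=
  (surface_measure Om \x sphere_measure d)%E.

Definition V0 (v : X * X -> R) : Prop := v \_ phase \in Lfun volD 2%:E.

(* L^2(B; |s.n|) for B a subset of the boundary of D *)
Definition L2bd (B : set (X * X)) (v : X * X -> R) : Prop :=
  ((fun z : surface_type Om * X => Num.sqrt `|sn z| * v z) \_ B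
     : surface_type Om * X -> R) \in Lfun volbdD 2%:E.

Definition ip (v w : X * X -> R) : R := \int[volD]_(z in phase) (v z * w z).

Definition intbd (B : set (X * X)) (f : X * X -> R) : R :=
  \int[volbdD]_(z in B) f z.

Definition even_part (v : X * X -> R) z := 2^-1 * (v z + v (z.1, - z.2)).
Definition odd_part (v : X * X -> R) z := 2^-1 * (v z - v (z.1, - z.2)).

(* An element of V1, given by a function v on D, its derivative s.grad v and its
   trace on the boundary of D. *)
Record field := Field {
  fval : X * X -> R;
  fdir : X * X -> R;
  ftr : X * X -> R }.

Definition field_sub u v := Field (fval u \- fval v) (fdir u \- fdir v)
  (ftr u \- ftr v).

(* s.grad phi is the derivative of phi at (r, s) in the direction (s, 0). *)
Definition field_of (phi : X * X -> R) :=
  Field phi (fun z => 'D_(z.2, 0) phi z) phi.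

Definition regular u := [/\ V0 (fval u), V0 (fdir u) & L2bd bdD (ftr u)].

Definition V1_sqnorm u : \bar R :=
  (\int[volD]_(z in phase) (fval u z ^+ 2)%:E
   + \int[volD]_(z in phase) (fdir u z ^+ 2)%:E
   + \int[volbdD]_(z in inflow) (`|sn z| * ftr u z ^+ 2)%:E)%E.

Definition outflow_sqnorm u : \bar R :=
  (\int[volbdD]_(z in outflow) (`|sn z| * ftr u z ^+ 2)%:E)%E.

(* V1 as the completion of the smooth functions on the closure of D, these being
   the restrictions of the smooth functions on R^d * R^d: the triples which are
   limits, for the V1 norm, of triples given by such functions. By Green's
   formula
     2 (s.grad v, v) = \int_(bdD) s.n v^2,
   a sequence which converges for the V1 norm converges in L^2(outflow; |s.n|)
   as well; its limit there is the outflow part of the trace. *)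
Definition V1 u := regular u /\
  exists phi : nat -> X * X -> R,
    [/\ forall k, smooth (phi k) /\ regular (field_of (phi k)),
        V1_sqnorm (field_sub (field_of (phi k)) u) @[k --> \oo] --> 0%E &
        outflow_sqnorm (field_sub (field_of (phi k)) u) @[k --> \oo] --> 0%E].

(* The derivative s.grad (v^+) is the odd part of s.grad v. *)
Definition field_even u :=
  Field (even_part (fval u)) (odd_part (fdir u)) (even_part (ftr u)).

(* A pair (u^+, u^-) *)
Record parity := Parity { pplus : field; pminus : X * X -> R }.

Definition W w :=
  (exists2 v, V1 v & pplus w = field_even v) /\
  (exists2 v, V0 v & pminus w = odd_part v).

Definition pval w z := fval (pplus w) z + pminus w z.

Section forms.
Variables (sigma_s sigma_t : X -> R) (theta : R -> R) (q qb : X * X -> R).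

Definition scatter (v : X * X -> R) (z : X * X) : R :=
  sigma_s z.1 *
  \int[sphere_measure d]_(s' in usphere) (theta (edot z.2 s') * v (z.1, s')).

Definition form_t (u v : parity) : R :=
  ip (fdir (pplus u)) (pminus v) - ip (pminus u) (fdir (pplus v))
  + ip (fun z => sigma_t z.1 * pval u z) (pval v)
  + intbd bdD (fun z => `|sn z| * ftr (pplus u) z * ftr (pplus v) z).

Definition form_s (u v : parity) : R := ip (scatter (pval u)) (pval v).

Definition form_l (v : parity) : R :=
  ip q (pval v) - 2 * intbd inflow (fun z => sn z * qb z * ftr (pplus v) z).

(* r is the value at w of the preconditioned residual operator. It is unique as
   an element of W, since form_t w w >= (sigma_t w, w). *)
Definition is_residual (w r : parity) := W r /\
  forall v, W v -> form_t r v = form_l v - form_t w v + form_s w v.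

End forms.

Definition weighted_norm (sigma : X -> R) (w : parity) : \bar R :=
  ('N[volD]_2%:E[EFin \o ((fun z => Num.sqrt (sigma z.1) * pval w z)%R \_ phase)])%E.

Definition Linf (f : X -> R) : Prop := f \_ Om \in Lfun (leb d) +oo%E.

Definition Linf_norm (f : X -> R) : \bar R :=
  ('N[leb d]_+oo[EFin \o (f \_ Om)])%E.

End phase_space.

(* Main.v *)
(* Subtracting the equation of u_(k+1/2) from that of the residual r_k shows that
   r_k and u_(k+1/2) - u_k have the same image under t. Since the transport terms
   of t cancel on the diagonal, t(e, e) >= (sigma_t e, e), so the difference e of
   these two elements has zero sigma_t-energy. In the same way
     t(r_(k+1/2), v) = s(u_(k+1/2) - u_k, v),
   and testing with v = r_(k+1/2) bounds ||r_(k+1/2)||^2 by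
   s(u_(k+1/2) - u_k, r_(k+1/2)).

   To bound s(f, g), view it as the integral over (r, s, s') of
   sigma_s(r) theta(s.s') f(r, s') g(r, s). By the AM-GM inequality the integrand is
   at most sigma_s theta (c f(r, s')^2 + g(r, s)^2 / c) / 2; by Tonelli, the symmetry
   and the normalization of theta, and sigma_s <= rho sigma_t, this integrates to
   rho (c ||f||^2 + ||g||^2 / c) / 2. Optimizing in c gives rho ||f|| ||g||.

   Splitting these integrals requires the even and odd parts of L^2 functions to
   be in L^2, i.e. the invariance of all the measures under s |-> -s. *)

Require Import Defs.
From HB Require Import structures.
From mathcomp Require Import all_boot all_order all_algebra.
From mathcomp Require Import all_classical all_reals all_analysis measurable_realfun.
From mathcomp Require Import ring lra ess_sup_inf.

Set Implicit Arguments.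
Unset Strict Implicit.
Unset Printing Implicit Defensive.

Import Order.TTheory GRing.Theory Num.Theory.
Import numFieldNormedType.Exports.

Local Open Scope classical_set_scope.
Local Open Scope ring_scope.

(** * Sigma-finite measures from a separate proof *)

Section sigma_finite_copy.
Context d (T : measurableType d) (R : realType) (mu : {measure set T -> \bar R}).

(* The values of the recursive function [leb] cannot carry a sigma-finite
   instance; an alias taking the proof as an argument can. *)
Definition sigma_finite_copy (muT : sigma_finite setT mu) : set T -> \bar R := mu.

Variable muT : sigma_finite setT mu.

HB.instance Definition _ := Measure.on (sigma_finite_copy muT).
HB.instance Definition _ :=
  Measure_isSigmaFinite.Build _ _ _ (sigma_finite_copy muT) muT.
End sigma_finite_copy.

(** * Borel sets and the inner product of Euclidean space *)

Section euclidean_measurability.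
Context {R : realType} {n : nat}.
Implicit Types (A : set 'rV[R]_n) (x y : 'rV[R]_n).

Lemma measurable_usphere : measurable (@usphere R n).
Proof.
rewrite (_ : usphere = @enorm R n @^-1` [set 1])//.
by rewrite -[X in measurable X]setTI; exact: measurable_enorm.
Qed.

(** The sigma-algebra is generated by the coordinates, so [A] is written as the countable union of
    the boxes inside it with rational centre and radius [1/(k+1)]. *)
Lemma open_measurable_rV A : open A -> measurable A.
Proof.
move=> oA.
pose box (q : 'rV[rat]_n * nat) : set 'rV[R]_n :=
  [set x | forall i, ball (ratr (q.1 0 i) : R) q.2.+1%:R^-1 (x 0 i)].
have mbox q : measurable (box q).
  rewrite (_ : box q = \bigcap_(i in [set: 'I_n])
      (@rV_coord R n i @^-1` (ball (ratr (q.1 0 i) : R) q.2.+1%:R^-1))).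
    apply: fin_bigcap_measurable => // i _.
    rewrite -[X in measurable X]setTI; apply: measurable_rV_coord => //.
    exact: measurable_ball.
  by apply/seteqP; split => x /= xP i; [move=> _; exact: xP|exact: (xP i I)].
rewrite (_ : A = \bigcup_q (if `[< box q `<=` A >] then box q else set0)).
  apply: countable_bigcupT_measurable => [|q]; last by case: ifP.
  exact: countableP.
apply/seteqP; split => [x Ax|x [q _]]; last by case: ifPn => // /asboolP; exact.
have := oA _ Ax; rewrite -nbhs_ballE => -[e /= e0 xeA].
(* Points of the box chosen below are within [2/(k+1)] of [x] in each coordinate, hence in the
   sup-norm ball of radius [e]. *)
have [k ke] : exists k : nat, k.+1%:R^-1 < e / 2.
  exists (Num.truncn (e / 2)^-1).
  rewrite invf_plt ?posrE ?divr_gt0//.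
  exact: truncnS_gt.
have k0 : 0 < k.+1%:R^-1 :> R by rewrite invr_gt0.
have /choice[q qP] : forall i : 'I_n, exists q : rat, ball (x 0 i) k.+1%:R^-1 (ratr q : R).
  move=> i; have : x 0 i - k.+1%:R^-1 < x 0 i + k.+1%:R^-1.
    by rewrite ltrD2l gtrN.
  move=> /rat_in_itvoo[q]; rewrite in_itv/= => /andP[q1 q2]; exists q.
  by rewrite /ball/= ltr_distlC q1 q2.
exists (\row_i q i, k) => //=.
rewrite asboolT; first by move=> i /=; rewrite mxE; apply: ball_sym; exact: qP.
move=> y /= yq; apply: xeA; split => // i j; rewrite ord1.
apply: (@le_ball _ _ _ (k.+1%:R^-1 + k.+1%:R^-1)).
  by rewrite [leRHS]splitr lerD// ltW.
apply: ball_triangle (qP j) _.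
by have := yq j; rewrite mxE.
Qed.

Lemma edotC x y : edot x y = edot y x.
Proof. by apply: eq_bigr => i _; rewrite mulrC. Qed.

Lemma edotNr x y : edot x (- y) = - edot x y.
Proof. by rewrite /edot -sumrN; apply: eq_bigr => i _; rewrite mxE mulrN. Qed.

Lemma edot_ge0 x : 0 <= edot x x.
Proof. by apply: sumr_ge0 => i _; rewrite -expr2 sqr_ge0. Qed.

Lemma enormN x : enorm (- x) = enorm x.
Proof. by rewrite /enorm edotNr edotC edotNr opprK. Qed.

Lemma usphereN x : usphere (- x) = usphere x.
Proof. by rewrite /usphere /= enormN. Qed.

(** Cauchy-Schwarz for unit vectors, from [|x + y|^2 >= 0] and [|x - y|^2 >= 0]. It keeps the
    argument of [theta] in its domain. *)
Lemma edot_usphere x y : usphere x -> usphere y -> edot x y \in `[-1, 1].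
Proof.
have edot1 (z : 'rV[R]_n) : usphere z -> edot z z = 1.
  move=> z1; rewrite -(sqr_sqrtr (edot_ge0 z)).
  by rewrite -/(enorm z) (z1 : enorm z = 1) expr1n.
move=> /edot1 x1 /edot1 y1; rewrite in_itv /=; apply/andP; split.
  have : 0 <= edot (x + y) (x + y) by exact: edot_ge0.
  rewrite (_ : edot (x + y) (x + y) = edot x x + edot y y + 2 * edot x y); last first.
    rewrite /edot mulr_sumr -!big_split/=; apply: eq_bigr => i _.
    by rewrite !mxE; ring.
  by rewrite x1 y1; lra.
have : 0 <= edot (x - y) (x - y) by exact: edot_ge0.
rewrite (_ : edot (x - y) (x - y) = edot x x + edot y y - 2 * edot x y); last first.
  rewrite /edot mulr_sumr -big_split -sumrB/=; apply: eq_bigr => i _.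
  by rewrite !mxE; ring.
by rewrite x1 y1; lra.
Qed.

End euclidean_measurability.

Lemma measurable_fun_edot {R : realType} n d (T : measurableType d)
    (f g : T -> 'rV[R]_n) :
  measurable_fun setT f -> measurable_fun setT g ->
  measurable_fun setT (fun t => edot (f t) (g t)).
Proof.
move=> /measurable_fun_rVP mf /measurable_fun_rVP mg.
by apply: measurable_sum => i; exact: measurable_funM.
Qed.

(** * Invariance of the measures under reflection of the direction *)

Section reflection.
Context {R : realType}.

Let cube n (k : nat) : set 'rV[R]_n := [set x | forall i, x 0 i \in `[- k%:R, k%:R]].

Let measurable_cube n k : measurable (@cube n k).
Proof.
rewrite (_ : @cube n k =
    \bigcap_(i in [set: 'I_n]) (@rV_coord R n i @^-1` `[- k%:R, k%:R])).
  apply: fin_bigcap_measurable => // i _.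
  by rewrite -[X in measurable X]setTI; exact: measurable_rV_coord.
by apply/seteqP; split => x /= xP i; [move=> _; exact: xP|exact: (xP i I)].
Qed.

Let leb_cube n k : (leb n (@cube n k) < +oo)%E.
Proof.
elim: n => [|n IH]; first by rewrite /= diracE ltry.
rewrite /= /pushforward (_ : _ @^-1` _ = @cube n k `*` `[- k%:R, k%:R]).
  rewrite product_measure1E//=; last exact: measurable_cube.
  rewrite lte_mul_pinfty ?ge0_fin_numE ?measure_ge0//.
  by rewrite lebesgue_measure_itv /=; case: ifPn => _; rewrite ltry.
apply/seteqP; split => [x xP|x [x1 x2] i] /=.
  split=> [i|].
    by have := xP (lift ord_max i); rewrite mxE liftK.
  by have := xP ord_max; rewrite mxE unlift_none.
by rewrite mxE; case: unliftP => [j _|_]; [exact: x1|exact: x2].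
Qed.

Lemma sigma_finite_leb n : sigma_finite setT (@leb R n).
Proof.
exists (@cube n) => [|k]; last by split; [exact: measurable_cube|exact: leb_cube].
apply/seteqP; split => // x _.
exists (Num.truncn (enorm x)).+1 => // i /=.
have xi : `|x 0 i| <= enorm x.
  rewrite -sqrtr_sqr ler_wsqrtr// /edot (bigD1 i)//= expr2 lerDl.
  by apply: sumr_ge0 => j _; rewrite -expr2 sqr_ge0.
rewrite in_itv/= -ler_norml (le_trans xi)// ltW// truncnS_gt//.
Qed.

Lemma measurable_oppr_rV n : measurable_fun setT (@GRing.opp 'rV[R]_n).
Proof.
apply/measurable_fun_rVP => i.
rewrite (_ : (fun _ => _) = -%R \o @rV_coord R n i).
  by apply: measurableT_comp => //; exact: measurable_rV_coord.
by apply/funext => x /=; rewrite mxE.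
Qed.

(** Induction on the dimension: negation commutes with appending a coordinate, so the two factors of
    the product are reflected one after the other. *)
Lemma leb_oppr n (A : set 'rV[R]_n) : measurable A -> leb n (-%R @^-1` A) = leb n A.
Proof.
elim: n A => [|n IH] A mA.
  rewrite (_ : -%R @^-1` A = A)//.
  by apply/seteqP; split => x /=; rewrite (thinmx0 (- x)) (thinmx0 x).
rewrite /= /pushforward.
set B : set ('rV[R]_n * measurableTypeR R) := @rV_snoc R n @^-1` A.
have mB : measurable B.
  by rewrite -[B]setTI; exact: measurable_rV_snoc.
have -> : @rV_snoc R n @^-1` (-%R @^-1` A) = [set z | B (- z.1, - z.2)].
  apply/seteqP; split => -[x y] /=.
    rewrite /B /=; congr A; apply/rowP => i; rewrite !mxE/=.
    by case: unlift => //= j; rewrite mxE.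
  rewrite /B /=; congr A; apply/rowP => i; rewrite !mxE/=.
  by case: unlift => //= j; rewrite mxE.
pose h x := @lebesgue_measure R (xsection B x).
(* The last coordinate first: the section at [x] of the reflected set is the reflected section of
   [B] at [- x]. *)
transitivity (\int[leb n]_x h (- x)%R)%E.
  apply: eq_integral => x _ /=; rewrite /h -(lebesgue_measureN (measurable_xsection (- x) mB)).
  by congr (lebesgue_measure _); apply/seteqP; split => y; rewrite /xsection /= !inE.
have mh : measurable_fun setT h by exact: measurable_fun_xsection.
(* Then the other coordinates: the induction hypothesis identifies the image of [leb n] under
   negation with [leb n]. *)
transitivity (\int[pushforward (leb n) (@GRing.opp 'rV[R]_n)]_x h x)%E.
  by rewrite (ge0_integral_pushforward (@measurable_oppr_rV n)).
apply: eq_measure_integral => [|mN C mC _]; first exact: measurable_oppr_rV.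
exact: IH.
Qed.

(** [normalize] commutes with negation and [uball] is symmetric, so the cone over the reflected set
    is the reflected cone. *)
Lemma sphere_measure_oppr n (A : set 'rV[R]_n) : measurable A ->
  sphere_measure n (-%R @^-1` A) = sphere_measure n A.
Proof.
move=> mA; rewrite /sphere_measure /= /mscale /=; congr (_ * _)%E.
rewrite /pushforward /mrestr.
pose B : set 'rV[R]_n := (@normalize R n) @^-1` A `&` uball.
rewrite -[in RHS](@leb_oppr n B).
  congr (leb n _); apply/seteqP; split => x;
    by rewrite /B /= /uball /normalize /= enormN scalerN.
apply: measurableI; last exact: measurable_uball.
by rewrite -[X in measurable X]setTI; exact: measurable_normalize.
Qed.

Definition flip {T n} (z : T * 'rV[R]_n) : T * 'rV[R]_n := (z.1, - z.2).

Lemma measurable_flip d (T : measurableType d) n :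
  measurable_fun setT (@flip T n).
Proof.
apply/measurable_fun_pairP; split; first exact: measurable_fst.
by apply: measurableT_comp measurable_snd; exact: measurable_oppr_rV.
Qed.

(** The product measure integrates the measures of the sections, and each section is reflected. The
    general first factor serves both [volD] and [volbdD]. *)
Lemma flip_invariant d (T : measurableType d) n (mu : {measure set T -> \bar R})
    (A : set (T * 'rV[R]_n)) :
  measurable A -> (mu \x sphere_measure n)%E (flip @^-1` A) = (mu \x sphere_measure n)%E A.
Proof.
move=> mA; apply: eq_integral => x _ /=.
rewrite -(sphere_measure_oppr (measurable_xsection x mA)).
by congr (sphere_measure n _); apply/seteqP; split => s; rewrite /xsection /= !inE.
Qed.

End reflection.

(** * Square-integrable functions on a subset *)

Section L2on.
Context d (T : measurableType d) (R : realType) (mu : {measure set T -> \bar R}).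
Implicit Types (f g h : T -> R) (A : set T).

Lemma Lfun2P f : f \in Lfun mu 2%:E <->
  measurable_fun setT f /\ (\int[mu]_x (f x ^+ 2)%:E < +oo)%E.
Proof.
split=> [fL|[mf foo]].
  split; first by move: fL; rewrite inE => /andP[+ _]; rewrite inE.
  have /integrableP[_] := Lfun2_integrable_sqr fL.
  by apply: le_lt_trans; under [leRHS]eq_integral do rewrite /= ger0_norm ?sqr_ge0//.
rewrite inE; apply/andP; split; rewrite inE//=.
rewrite /finite_norm unlock poweR_lty//.
apply: le_lt_trans foo.
by under eq_integral do rewrite /= powR_mulrn// -normrX ger0_norm ?sqr_ge0//.
Qed.

(** [V0] and [L2bd] are instances of this predicate by unfolding. *)
Definition L2on A f := f \_ A \in Lfun mu 2%:E.

Let le12 : (1 <= 2%:E :> \bar R)%E. Proof. by rewrite lee_fin ler1n. Qed.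

Lemma L2onD A f g : L2on A f -> L2on A g -> L2on A (f \+ g).
Proof.
move=> fA gA; rewrite /L2on (_ : _ \_ A = (f \_ A) + (g \_ A)); last first.
  by apply/funext => x; rewrite !fctE /patch; case: ifP => //; rewrite addr0.
exact: (Lfun_addr_closed mu le12).2.
Qed.

Lemma L2onB A f g : L2on A f -> L2on A g -> L2on A (f \- g).
Proof.
move=> fA gA; rewrite /L2on (_ : _ \_ A = (f \_ A) + - (g \_ A)); last first.
  by apply/funext => x; rewrite !fctE /patch; case: ifP => //; rewrite subr0.
apply: (Lfun_addr_closed mu le12).2 => //.
exact: Lfun_oppr_closed.
Qed.

Lemma L2on_scale A f (c : R) : L2on A f -> L2on A (fun x => c * f x).
Proof.
move=> fA; rewrite /L2on (_ : _ \_ A = c \o* (f \_ A)); last first.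
  by apply/funext => x /=; rewrite /patch; case: ifP => //; rewrite ?mul0r// mulrC.
by apply: Lfun_scale => //; rewrite ler1n.
Qed.

Lemma L2on_measurable A f : L2on A f -> measurable_fun setT (f \_ A).
Proof. by move=> /Lfun2P[]. Qed.

Lemma L2on_mul A f g : measurable A -> L2on A f -> L2on A g ->
  mu.-integrable A (EFin \o (fun x => f x * g x)).
Proof.
move=> mA fA gA; rewrite integrable_mkcond// restrict_EFin.
apply/Lfun1_integrable.
rewrite (_ : _ \_ A = (f \_ A) \* (g \_ A)); first exact: Lfun2_mul_Lfun1.
by apply/funext => x /=; rewrite /patch; case: ifP => //; rewrite mul0r.
Qed.

(** As [A] is invariant under [phi], restriction to [A] commutes with composition; the change of
    variables then preserves the integral of the square. *)
Lemma L2on_comp (phi : T -> T) A f :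
  measurable_fun setT phi ->
  (forall B, measurable B -> mu (phi @^-1` B) = mu B) ->
  (forall x, A (phi x) = A x) -> L2on A f -> L2on A (f \o phi).
Proof.
move=> mphi muphi phiA /Lfun2P[mf foo].
have E : (f \o phi) \_ A = (f \_ A) \o phi.
  apply/funext => x; rewrite /patch /= (_ : (phi x \in A) = (x \in A))//.
  by apply/idP/idP; rewrite !inE phiA.
apply/Lfun2P; rewrite E; split; first exact: measurableT_comp mf mphi.
apply: le_lt_trans foo; rewrite le_eqVlt; apply/orP; left; apply/eqP.
have mf2 : measurable_fun setT (fun x => ((f \_ A) x ^+ 2)%:E).
  by apply/measurable_EFinP; exact: measurable_funX.
transitivity (\int[pushforward mu phi]_x ((f \_ A) x ^+ 2)%:E)%E.
  rewrite (ge0_integral_pushforward mphi)// => x _.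
  by rewrite lee_fin sqr_ge0.
by apply: eq_measure_integral => B mB _; exact: muphi.
Qed.

(** Splitting a real integral requires integrable terms; products of two L^2 functions are. *)
Lemma Rintegral_mulBl A f g h : measurable A -> L2on A f -> L2on A g -> L2on A h ->
  \int[mu]_(x in A) ((f x - g x) * h x) =
  \int[mu]_(x in A) (f x * h x) - \int[mu]_(x in A) (g x * h x).
Proof.
move=> mA fA gA hA; rewrite -RintegralB//; [|exact: L2on_mul..].
by apply: eq_Rintegral => x _; rewrite mulrBl.
Qed.

Lemma Rintegral_mulBr A f g h : measurable A -> L2on A f -> L2on A g -> L2on A h ->
  \int[mu]_(x in A) (h x * (f x - g x)) =
  \int[mu]_(x in A) (h x * f x) - \int[mu]_(x in A) (h x * g x).
Proof.
move=> mA fA gA hA; rewrite -RintegralB//; [|exact: L2on_mul..].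
by apply: eq_Rintegral => x _; rewrite mulrBr.
Qed.

Lemma L2on_bounded_mul A f g (M : R) : measurable A ->
  measurable_fun setT (g \_ A) -> {ae mu, forall x, A x -> `|g x| <= M} ->
  L2on A f -> L2on A (fun x => g x * f x).
Proof.
move=> mA mg gM fA; have [mf foo] := (Lfun2P _).1 fA.
have E : (fun x => g x * f x) \_ A = (g \_ A) \* (f \_ A).
  by apply/funext => x /=; rewrite /patch; case: ifP => //; rewrite mul0r.
have mgf : measurable_fun setT ((fun x => g x * f x) \_ A).
  by rewrite E; exact: measurable_funM.
apply/Lfun2P; split => //.
apply: (@le_lt_trans _ _ (\int[mu]_x (M ^+ 2 * (f \_ A) x ^+ 2)%:E)%E).
  apply: ae_ge0_le_integral => //.
  - by move=> x _; rewrite lee_fin sqr_ge0.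
  - by apply/measurable_EFinP; exact: measurable_funX.
  - by move=> x _; rewrite lee_fin mulr_ge0 ?sqr_ge0.
  - by apply/measurable_EFinP; apply: measurable_funM => //; exact: measurable_funX.
  apply: filterS gM => x gM _; rewrite lee_fin E/= exprMn ler_wpM2r ?sqr_ge0//.
  rewrite /patch; case: ifPn => [/set_mem Ax|_]; last by rewrite expr0n sqr_ge0.
  by rewrite -[leLHS]real_normK ?num_real// lerXn2r ?nnegrE ?(le_trans _ (gM Ax)) ?gM.
under eq_integral do rewrite EFinM.
rewrite ge0_integralZl//.
- by rewrite lte_mul_pinfty ?lee_fin ?sqr_ge0.
- by apply/measurable_EFinP; exact: measurable_funX.
- by move=> x _; rewrite lee_fin sqr_ge0.
- by rewrite lee_fin sqr_ge0.
Qed.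

End L2on.

(** * Integrability of the elements of [W] and the form [t] *)

Section phase_space_regularity.
Context {R : realType} {d : nat} (Om : set 'rV[R]_d) (nu : 'rV[R]_d -> 'rV[R]_d).
Local Notation X := 'rV[R]_d.
Hypothesis Om_open : open Om.

Lemma measurable_phase : measurable (phase Om : set (X * X)).
Proof. by apply: measurableX; [exact: open_measurable_rV|exact: measurable_usphere]. Qed.

(** [surface_outer] vanishes on sets disjoint from [bd Om], so the Caratheodory inequality reduces
    to monotonicity. *)
Lemma measurable_bd : measurable (bd Om : set (surface_type Om)).
Proof.
apply: le_caratheodory_measurable => A /=.
rewrite [X in (_ + X)%E](_ : _ = 0%E).
  by rewrite adde0; apply: le_outer_measure; exact: subIsetl.
rewrite /surface_outer (_ : _ `&` bd Om = set0) ?hausdorff0//.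
by rewrite -setIA setICl setI0.
Qed.

Lemma measurable_bdD : measurable (bdD Om : set (surface_type Om * X)).
Proof. by apply: measurableX; [exact: measurable_bd|exact: measurable_usphere]. Qed.

Lemma phase_flip (z : X * X) : phase Om (flip z) = phase Om z.
Proof. by rewrite /phase /setX /= usphereN. Qed.

Lemma bdD_flip (z : X * X) : bdD Om (flip z) = bdD Om z.
Proof. by rewrite /bdD /setX /= usphereN. Qed.

Lemma sn_flip (z : X * X) : sn nu (flip z) = - sn nu z.
Proof. by rewrite /sn /= edotC edotNr edotC. Qed.

Lemma V0_flip v : V0 Om v -> V0 Om (v \o flip).
Proof.
apply: L2on_comp => [|B mB|z]; first exact: measurable_flip.
- exact: flip_invariant.
- exact: phase_flip.
Qed.

Lemma V0_even_part v : V0 Om v -> V0 Om (even_part v).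
Proof. by move=> vL; apply: L2on_scale; apply: L2onD => //; exact: V0_flip. Qed.

Lemma V0_odd_part v : V0 Om v -> V0 Om (odd_part v).
Proof. by move=> vL; apply: L2on_scale; apply: L2onB => //; exact: V0_flip. Qed.

(** [sn] changes sign under [flip], so the weight is invariant and can be moved inside the even
    part. *)
Lemma L2bd_even_part v : L2bd Om nu (bdD Om) v -> L2bd Om nu (bdD Om) (even_part v).
Proof.
move=> vL; pose v' (z : surface_type Om * X) := Num.sqrt `|sn nu z| * v z.
have v'L : L2on (volbdD Om) (bdD Om) v' by [].
rewrite /L2bd (_ : (fun z : surface_type Om * X => _) =
    (fun z => 2^-1 * (v' \+ (v' \o flip)) z)).
  apply: L2on_scale; apply: L2onD => //.
  apply: L2on_comp v'L => [|B mB|z]; first exact: measurable_flip.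
  - exact: flip_invariant.
  - exact: bdD_flip.
apply/funext => z; rewrite /even_part /v' /= sn_flip normrN.
by rewrite -mulrDr mulrCA.
Qed.

(** The integrability on which additivity of the forms rests. It passes to differences without any
    appeal to the approximation by smooth functions in [V1]. *)
Record regular_parity (w : @parity R d) : Prop := RegularParity {
  regular_fdir : V0 Om (fdir (pplus w)) ;
  regular_pminus : V0 Om (pminus w) ;
  regular_pval : V0 Om (pval w) ;
  regular_ftr : L2bd Om nu (bdD Om) (ftr (pplus w)) }.

Lemma W_regular w : W Om nu w -> regular_parity w.
Proof.
move=> [[v [[v0 dv0 tv0] _] vE] [v' v'0 v'E]]; split.
- by rewrite vE; exact: V0_odd_part.
- by rewrite v'E; exact: V0_odd_part.
- rewrite /pval vE v'E; apply: L2onD; [exact: V0_even_part|exact: V0_odd_part].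
- by rewrite vE; exact: L2bd_even_part.
Qed.

Definition parity_sub (u v : @parity R d) :=
  Parity (field_sub (pplus u) (pplus v)) (pminus u \- pminus v).

Lemma pval_sub u v : pval (parity_sub u v) = pval u \- pval v.
Proof. by apply/funext => z; rewrite /pval /=; ring. Qed.

Lemma regular_parity_sub u v :
  regular_parity u -> regular_parity v -> regular_parity (parity_sub u v).
Proof.
move=> [u1 u2 u3 u4] [v1 v2 v3 v4]; split.
- exact: L2onB.
- exact: L2onB.
- by rewrite pval_sub; exact: L2onB.
- rewrite /L2bd (_ : (fun z : surface_type Om * X => _) =
    ((fun z => Num.sqrt `|sn nu z| * ftr (pplus u) z) \-
     (fun z => Num.sqrt `|sn nu z| * ftr (pplus v) z))); first exact: L2onB.
  by apply/funext => z /=; rewrite mulrBr.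
Qed.

Let wtr (f : X * X -> R) (z : surface_type Om * X) := Num.sqrt `|sn nu z| * f z.

(** Giving a square root of the weight to each factor makes the boundary term an L^2 pairing. *)
Let intbdE f g : intbd Om (bdD Om) (fun z => `|sn nu z| * f z * g z) =
  \int[volbdD Om]_(z in bdD Om) (wtr f z * wtr g z).
Proof.
apply: eq_Rintegral => z _; rewrite /wtr mulrACA -expr2 sqr_sqrtr//.
by rewrite mulrA.
Qed.

Variable sigma_t : X -> R.
Hypothesis V0_sigma_t : forall f, V0 Om f -> V0 Om (fun z => sigma_t z.1 * f z).

Lemma form_t_subl u v w :
    regular_parity u -> regular_parity v -> regular_parity w ->
  form_t Om nu sigma_t (parity_sub u v) w =
  form_t Om nu sigma_t u w - form_t Om nu sigma_t v w.
Proof.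
move=> [u1 u2 u3 u4] [v1 v2 v3 v4] [w1 w2 w3 w4].
rewrite /form_t !intbdE pval_sub /ip /=.
(* The differences under the factors [sigma_t] and [sqrt |s.n|] are expanded, so that every term has
   the shape [(f - g) * h]. *)
under [X in _ + X + _ = _]eq_Rintegral do rewrite mulrBr.
under [X in _ + X = _]eq_Rintegral do rewrite {1}/wtr mulrBr -!/(wtr _ _).
rewrite !Rintegral_mulBl//; try exact: V0_sigma_t; try exact: measurable_phase;
  try exact: measurable_bdD.
by ring.
Qed.

Lemma form_t_subr u v w :
    regular_parity u -> regular_parity v -> regular_parity w ->
  form_t Om nu sigma_t w (parity_sub u v) =
  form_t Om nu sigma_t w u - form_t Om nu sigma_t w v.
Proof.
move=> [u1 u2 u3 u4] [v1 v2 v3 v4] [w1 w2 w3 w4].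
rewrite /form_t !intbdE pval_sub /ip /=.
under [X in _ + X = _]eq_Rintegral do rewrite {2}/wtr mulrBr -!/(wtr _ _).
rewrite !Rintegral_mulBr//; try exact: V0_sigma_t; try exact: measurable_phase;
  try exact: measurable_bdD.
by ring.
Qed.

Lemma form_t_ge w : ip Om (fun z => sigma_t z.1 * pval w z) (pval w) <=
  form_t Om nu sigma_t w w.
Proof.
rewrite /form_t [X in X - _](_ : _ = ip Om (pminus w) (fdir (pplus w))).
  rewrite subrr add0r lerDl; apply: Rintegral_ge0 => z _.
  by rewrite -mulrA mulr_ge0// -expr2 sqr_ge0.
by apply: eq_Rintegral => z _; rewrite mulrC.
Qed.

End phase_space_regularity.

(** * Product measures and partial integrals *)

Lemma sigma_finite_product d1 d2 (T1 : measurableType d1)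
    (T2 : measurableType d2) (R : realType)
    (m1 : {sigma_finite_measure set T1 -> \bar R})
    (m2 : {sigma_finite_measure set T2 -> \bar R}) :
  sigma_finite setT (m1 \x m2)%E.
Proof.
have /sigma_finiteP[F [TF ndF Foo]] := sigma_finiteT m1.
have /sigma_finiteP[G [TG ndG Goo]] := sigma_finiteT m2.
exists (fun n => F n `*` G n) => [|n]; last first.
  have [[mF muF] [mG muG]] := (Foo n, Goo n).
  split; first exact: measurableX.
  by rewrite product_measure1E// lte_mul_pinfty// ge0_fin_numE.
apply/esym; rewrite -subTset => -[x y] _.
have [i _ Fx] : (\bigcup_i F i) x by rewrite -TF.
have [j _ Gy] : (\bigcup_i G i) y by rewrite -TG.
(* Both exhausting sequences are nondecreasing, so the larger index serves both coordinates. *)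
exists (maxn i j) => //; split.
- by move: x Fx; exact/subsetPset/ndF/leq_maxl.
- by move: y Gy; exact/subsetPset/ndG/leq_maxr.
Qed.

(** Tonelli applies to the positive and the negative part separately, so the integrand may have any
    sign and need not be integrable. *)
Lemma measurable_partial_integral d1 d2 (T1 : measurableType d1)
    (T2 : measurableType d2) (R : realType)
    (m2 : {sigma_finite_measure set T2 -> \bar R}) (f : T1 * T2 -> \bar R) :
  measurable_fun setT f -> measurable_fun setT (fun x => \int[m2]_y f (x, y))%E.
Proof.
move=> mf; under eq_fun do rewrite integralE.
apply: emeasurable_funB.
  rewrite [X in measurable_fun _ X](_ : _ = fubini_F m2 f^\+%E); last first.
    by apply/funext => x; apply: eq_integral => y _; rewrite !funeposE.
  by apply: measurable_fun_fubini_tonelli_F => //; exact: measurable_funepos.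
rewrite [X in measurable_fun _ X](_ : _ = fubini_F m2 f^\-%E); last first.
  by apply/funext => x; apply: eq_integral => y _; rewrite !funenegE.
by apply: measurable_fun_fubini_tonelli_F => //; exact: measurable_funeneg.
Qed.

(** * Estimates and Fubini for a symmetric kernel *)

Section kernel_form.
Context d1 d2 (T1 : measurableType d1) (T2 : measurableType d2) (R : realType).
Variables (m1 : {sigma_finite_measure set T1 -> \bar R})
  (m2 : {sigma_finite_measure set T2 -> \bar R}).
Variables (a : T1 -> R) (k : T2 * T2 -> R).
Hypotheses (ma : measurable_fun setT a) (mk : measurable_fun setT k).
Hypotheses (k_ge0 : forall p, 0 <= k p) (k_sym : forall s t, k (s, t) = k (t, s)).
Hypothesis k_le1 : {ae m2, forall s, (\int[m2]_t (k (s, t))%:E <= 1)%E}.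
Implicit Types f g : T1 * T2 -> R.

(** The point [p] is [((r, s), s')]: [f] is taken at the scattered direction [s'], [g] at [s]. *)
Definition kernel_form f g (p : (T1 * T2) * T2) : R :=
  a p.1.1 * k (p.1.2, p.2) * f (p.1.1, p.2) * g p.1.

(* The library's sigma-finite instance on [m1 \x m2] is found for probabilities
   only. *)
Let m12 : {sigma_finite_measure set (T1 * T2)%type -> \bar R} :=
  sigma_finite_copy (sigma_finite_product m1 m2).

Let mrs : measurable_fun setT (fun p : (T1 * T2) * T2 => p.1.1).
Proof. exact: (measurableT_comp measurable_fst measurable_fst). Qed.

Let mss' : measurable_fun setT (fun p : (T1 * T2) * T2 => (p.1.2, p.2)).
Proof.
apply/measurable_fun_pairP; split; last exact: measurable_snd.
exact: (measurableT_comp measurable_snd measurable_fst).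
Qed.

Let mrs' : measurable_fun setT (fun p : (T1 * T2) * T2 => (p.1.1, p.2)).
Proof. by apply/measurable_fun_pairP; split; [exact: mrs|exact: measurable_snd]. Qed.

Let mak : measurable_fun setT (fun p : (T1 * T2) * T2 => a p.1.1 * k (p.1.2, p.2)).
Proof.
by apply: measurable_funM; [exact: measurableT_comp ma mrs|exact: measurableT_comp mk mss'].
Qed.

Let mabsak : measurable_fun setT (fun p : (T1 * T2) * T2 => `|a p.1.1| * k (p.1.2, p.2)).
Proof.
apply: measurable_funM; last exact: measurableT_comp mk mss'.
by apply: measurableT_comp => //; exact: measurableT_comp ma mrs.
Qed.

Let mf1 f : measurable_fun setT f ->
  measurable_fun setT (fun p : (T1 * T2) * T2 => f (p.1.1, p.2)).
Proof. by move=> mf; exact: measurableT_comp mf mrs'. Qed.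

Let mf2 f : measurable_fun setT f ->
  measurable_fun setT (fun p : (T1 * T2) * T2 => f p.1).
Proof. by move=> mf; exact: measurableT_comp mf measurable_fst. Qed.

Lemma measurable_kernel_form f g : measurable_fun setT f -> measurable_fun setT g ->
  measurable_fun setT (kernel_form f g).
Proof.
move=> mf mg; apply: measurable_funM; last exact: mf2.
by apply: measurable_funM; last exact: mf1.
Qed.

Let msq f : measurable_fun setT f ->
  measurable_fun setT (fun z : T1 * T2 => (`|a z.1| * f z ^+ 2)%:E).
Proof.
move=> mf; apply/measurable_EFinP; apply: measurable_funM; last exact: measurable_funX.
by apply: measurableT_comp => //; exact: (measurableT_comp ma measurable_fst).
Qed.

Let mk1 s : measurable_fun setT (fun t => (k (s, t))%:E).
Proof. by apply/measurable_EFinP; exact: (measurableT_comp mk (pair1_measurable s)). Qed.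

Let mk2 t : measurable_fun setT (fun s => (k (s, t))%:E).
Proof. by apply/measurable_EFinP; exact: (measurableT_comp mk (pair2_measurable t)). Qed.

Let ae_snd (P : T2 -> Prop) : {ae m2, forall s, P s} ->
  {ae (m1 \x m2)%E, forall z, P z.2}.
Proof.
move=> [N [mN N0 PN]]; exists (setT `*` N); split.
- exact: measurableX.
- by rewrite product_measure1E//= N0 mule0.
- by move=> z /= Pz; split => //; exact: PN.
Qed.

(** Here [f] does not depend on [s'], so integrating over [s'] first leaves the mass of the kernel,
    at most 1 for almost every [s]. *)
Lemma kernel_int_sqr_fst f : measurable_fun setT f ->
  (\int[(m1 \x m2) \x m2]_p (`|a p.1.1| * k (p.1.2, p.2) * f p.1 ^+ 2)%:E <=
   \int[m1 \x m2]_z (`|a z.1| * f z ^+ 2)%:E)%E.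
Proof.
move=> mf.
have mh : measurable_fun setT (fun p : (T1 * T2) * T2 =>
    (`|a p.1.1| * k (p.1.2, p.2) * f p.1 ^+ 2)%:E).
  apply/measurable_EFinP; apply: measurable_funM => //.
  by apply: measurable_funX; exact: mf2.
have h0 p : (0 <= (`|a p.1.1| * k (p.1.2, p.2) * f p.1 ^+ 2)%:E)%E.
  by rewrite lee_fin mulr_ge0 ?sqr_ge0 ?mulr_ge0.
rewrite [leLHS](fubini_tonelli1 (m1 := m12) _ mh h0) /fubini_F/=.
apply: ae_ge0_le_integral => //.
- by move=> z _; apply: integral_ge0 => t _; exact: h0 (z, t).
- exact: measurable_partial_integral mh.
- by move=> z _; rewrite lee_fin mulr_ge0 ?sqr_ge0.
- exact: msq.
apply: filterS (ae_snd k_le1) => -[r s] /= ks _.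
under eq_integral do rewrite mulrAC EFinM.
rewrite ge0_integralZl//; last 2 first.
- by move=> t _; rewrite lee_fin.
- by rewrite lee_fin mulr_ge0 ?sqr_ge0.
by rewrite -[leRHS]mule1 lee_wpmul2l// lee_fin mulr_ge0 ?sqr_ge0.
Qed.

(** Here [f] does not depend on [s], so [s] is integrated before [s']; the symmetry of [k] turns
    this into the assumed bound on its mass. *)
Lemma kernel_int_sqr_snd f : measurable_fun setT f ->
  (\int[(m1 \x m2) \x m2]_p (`|a p.1.1| * k (p.1.2, p.2) * f (p.1.1, p.2) ^+ 2)%:E <=
   \int[m1 \x m2]_z (`|a z.1| * f z ^+ 2)%:E)%E.
Proof.
move=> mf.
have mh : measurable_fun setT (fun p : (T1 * T2) * T2 =>
    (`|a p.1.1| * k (p.1.2, p.2) * f (p.1.1, p.2) ^+ 2)%:E).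
  apply/measurable_EFinP; apply: measurable_funM => //.
  by apply: measurable_funX; exact: mf1.
have h0 p : (0 <= (`|a p.1.1| * k (p.1.2, p.2) * f (p.1.1, p.2) ^+ 2)%:E)%E.
  by rewrite lee_fin mulr_ge0 ?sqr_ge0 ?mulr_ge0.
rewrite [leLHS](fubini_tonelli2 (m1 := m12) _ mh h0) /fubini_G/=.
(* The right-hand side also gets its direction as outermost variable, and the two sides are compared
   for almost every fixed [t]. *)
rewrite [leRHS]fubini_tonelli2//=; last 2 first.
- exact: msq.
- by move=> z; rewrite lee_fin mulr_ge0 ?sqr_ge0.
rewrite /fubini_G; apply: ae_ge0_le_integral => //.
- by move=> t _; apply: integral_ge0 => z _; exact: h0 (z, t).
- exact: (measurable_fun_fubini_tonelli_G (m1 := m12) _ mh h0).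
- by move=> t _; apply: integral_ge0 => r _; rewrite lee_fin mulr_ge0 ?sqr_ge0.
- apply: (measurable_fun_fubini_tonelli_G (m1 := m1) _ (msq mf)).
  by move=> z; rewrite lee_fin mulr_ge0 ?sqr_ge0.
apply: filterS k_le1 => t kt _.
have mht : measurable_fun setT (fun z : T1 * T2 =>
    (`|a z.1| * k (z.2, t) * f (z.1, t) ^+ 2)%:E).
  exact: (measurableT_comp mh (pair2_measurable t)).
rewrite [leLHS](fubini_tonelli1 (m1 := m1) (m2 := m2) _ mht) /fubini_F/=; last first.
  by move=> z; exact: (h0 (z, t)).
apply: ge0_le_integral => //.
- by move=> r _; apply: integral_ge0 => s _; exact: (h0 ((r, s), t)).
- exact: measurable_partial_integral mht.
- exact: (measurableT_comp (msq mf) (pair2_measurable t)).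
move=> r _.
under eq_integral do rewrite mulrAC EFinM.
rewrite ge0_integralZl//; last 2 first.
- by move=> s _; rewrite lee_fin.
- by rewrite lee_fin mulr_ge0 ?sqr_ge0.
rewrite -[leRHS]mule1; apply: lee_wpmul2l.
  by rewrite lee_fin mulr_ge0 ?sqr_ge0.
by under eq_integral do rewrite k_sym.
Qed.

(** The weight [c] stays free: it is optimized once the two integrals are known to be energies. *)
Lemma kernel_form_le f g (c : R) : 0 < c ->
  measurable_fun setT f -> measurable_fun setT g ->
  (\int[(m1 \x m2) \x m2]_p `|kernel_form f g p|%:E <=
   (c / 2)%:E * \int[m1 \x m2]_z (`|a z.1| * f z ^+ 2)%:E +
   (c^-1 / 2)%:E * \int[m1 \x m2]_z (`|a z.1| * g z ^+ 2)%:E)%E.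
Proof.
move=> c0 mf mg.
have c2 : 0 <= c / 2 by rewrite divr_ge0 ?ltW.
have c2' : 0 <= c^-1 / 2 by rewrite divr_ge0// invr_ge0 ltW.
pose hf (p : (T1 * T2) * T2) := `|a p.1.1| * k (p.1.2, p.2) * f (p.1.1, p.2) ^+ 2.
pose hg (p : (T1 * T2) * T2) := `|a p.1.1| * k (p.1.2, p.2) * g p.1 ^+ 2.
have hf0 p : 0 <= hf p by rewrite mulr_ge0 ?sqr_ge0 ?mulr_ge0.
have hg0 p : 0 <= hg p by rewrite mulr_ge0 ?sqr_ge0 ?mulr_ge0.
have mhf : measurable_fun setT hf.
  by apply: measurable_funM => //; apply: measurable_funX; exact: mf1.
have mhg : measurable_fun setT hg.
  by apply: measurable_funM => //; apply: measurable_funX; exact: mf2.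
apply: (@le_trans _ _ (\int[(m1 \x m2) \x m2]_p
    ((c / 2)%:E * (hf p)%:E + (c^-1 / 2)%:E * (hg p)%:E))%E).
  apply: ge0_le_integral => //.
  - apply/measurable_EFinP; apply: measurableT_comp => //.
    exact: measurable_kernel_form.
  - apply: emeasurable_funD; apply: measurable_funeM; exact/measurable_EFinP.
  move=> p _; rewrite -!EFinM -EFinD lee_fin /kernel_form /hf /hg.
  rewrite !normrM (ger0_norm (k_ge0 _)).
  set w := `|a _| * _; set x := f _; set y := g _.
  have w0 : 0 <= w by rewrite mulr_ge0.
  rewrite -[x ^+ 2]real_normK ?num_real// -[y ^+ 2]real_normK ?num_real//.
  (* AM-GM: [2 |x| |y| <= c |x|^2 + |y|^2 / c] *)
  rewrite -mulrA !(mulrCA _ w) -mulrDr ler_wpM2l//.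
  rewrite -subr_ge0 (_ : _ - _ = (c * `|x| - `|y|) ^+ 2 / (2 * c)).
    by rewrite divr_ge0 ?sqr_ge0// mulr_ge0// ltW.
  by field; rewrite gt_eqF.
rewrite ge0_integralD//; [|by move=> p _; rewrite mule_ge0// lee_fin|
  by apply: measurable_funeM; exact/measurable_EFinP|
  by move=> p _; rewrite mule_ge0// lee_fin|
  by apply: measurable_funeM; exact/measurable_EFinP].
rewrite !ge0_integralZl//; try by [exact/measurable_EFinP|move=> p _; rewrite lee_fin].
by apply: leeD; rewrite lee_wpmul2l ?lee_fin//;
  [exact: kernel_int_sqr_snd|exact: kernel_int_sqr_fst].
Qed.

Lemma integrable_kernel_form f g :
  measurable_fun setT f -> measurable_fun setT g ->
  (\int[m1 \x m2]_z (`|a z.1| * f z ^+ 2)%:E < +oo)%E ->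
  (\int[m1 \x m2]_z (`|a z.1| * g z ^+ 2)%:E < +oo)%E ->
  ((m1 \x m2) \x m2)%E.-integrable setT (EFin \o kernel_form f g).
Proof.
move=> mf mg foo goo; apply/integrableP; split.
  by apply/measurable_EFinP; exact: measurable_kernel_form.
apply: le_lt_trans (kernel_form_le ltr01 mf mg) _.
by rewrite lte_add_pinfty// lte_mul_pinfty// lee_fin// divr_ge0// invr_ge0.
Qed.

(** Fubini, with the factor [a g] pulled out of the inner integral for almost every [(r, s)]. *)
Lemma kernel_formE f g :
  measurable_fun setT f -> measurable_fun setT g ->
  ((m1 \x m2) \x m2)%E.-integrable setT (EFin \o kernel_form f g) ->
  \int[(m1 \x m2)%E]_z (a z.1 * \int[m2]_t (k (z.2, t) * f (z.1, t)) * g z) =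
  \int[((m1 \x m2) \x m2)%E]_p kernel_form f g p.
Proof.
move=> mf mg iF; rewrite /Rintegral -(integral12_prod_meas1 (m1 := m12) iF); congr fine.
have mkf : measurable_fun setT (fun p : (T1 * T2) * T2 =>
    (k (p.1.2, p.2) * f (p.1.1, p.2))%:E).
  apply/measurable_EFinP; apply: measurable_funM; last exact: mf1.
  exact: measurableT_comp mk mss'.
apply: ae_eq_integral => //.
- apply/measurable_EFinP; apply: measurable_funM => //.
  apply: measurable_funM; first exact: (measurableT_comp ma measurable_fst).
  apply: measurableT_comp => //.
  exact: measurable_partial_integral mkf.
- exact: (measurable_fubini_F (m1 := m12) iF).
apply: filterS (ae_integrable1 (m1 := m12) iF) => -[r s] /= iFz _.
rewrite /fubini_F /kernel_form /=.
(* Where [a g] vanishes both sides are 0, whether or not the inner integrand is integrable;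
   elsewhere dividing by [a g] yields its integrability. *)
have [ag0|ag0] := eqVneq (a r * g (r, s)) 0.
  rewrite mulrAC ag0 mul0r integral0_eq// => t _.
  rewrite (_ : _ * g (r, s) = a r * g (r, s) * (k (s, t) * f (r, t))); last by ring.
  by rewrite ag0 mul0r.
have ikf : m2.-integrable setT (fun t => (k (s, t) * f (r, t))%:E).
  rewrite (_ : (fun _ => _) = (fun t =>
      ((a r * g (r, s))^-1)%:E * (EFin \o kernel_form f g) ((r, s), t)))%E.
    exact: integrableZl.
  apply/funext => t; rewrite /= /kernel_form/= -EFinM; congr EFin.
  by move: (ag0); rewrite mulf_eq0 negb_or => /andP[a0 g0]; field; rewrite a0 g0.
under [RHS]eq_integral => t _.
  rewrite (_ : a r * k (s, t) * f (r, t) * g (r, s) =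
    (a r * g (r, s)) * (k (s, t) * f (r, t))); last by ring.
  rewrite EFinM; over.
rewrite integralZl// mulrAC EFinM fineK//.
exact: integrable_fin_num.
Qed.

End kernel_form.

(** * Essential bounds and optimization of the weight *)

Lemma Lnormy_ae d (T : measurableType d) (R : realType)
    (mu : {measure set T -> \bar R}) (f : T -> \bar R) (M : \bar R) :
  ('N[mu]_+oo[f] <= M)%E -> {ae mu, forall x, `|f x| <= M}%E.
Proof.
rewrite unlock; case: ifPn => [_ /ess_supP//|].
(* On a space of measure zero the norm is 0 by convention, but every set is negligible. *)
rewrite -leNgt measure_le0 => /eqP mu0 _.
by exists setT; split.
Qed.

(** The optimal weight is [c = sqrt x / sqrt y], for which the bound becomes [r sqrt x sqrt y]. *)
Lemma sqrt_le_of_young (R : realType) (x y r : R) : 0 <= x -> 0 <= y -> 0 <= r ->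
  (forall c, 0 < c -> x <= r * (c / 2 * y + c^-1 / 2 * x)) ->
  Num.sqrt x <= r * Num.sqrt y.
Proof.
move=> x0 y0 r0 H.
have [->|xN0] := eqVneq x 0; first by rewrite sqrtr0 mulr_ge0 ?sqrtr_ge0.
have xp : 0 < x by rewrite lt_def xN0.
have [yE|yN0] := eqVneq y 0.
  (* For [y = 0] the optimal weight is undefined; [c = r + 1] gives [x <= r / (2 (r + 1)) x < x], a
     contradiction. *)
  have := H (r + 1) (ltr_pwDr ltr01 r0); rewrite yE mulr0 add0r => h.
  suff : r * ((r + 1)^-1 / 2 * x) < x by rewrite ltNge h.
  rewrite mulrA gtr_pMl// mulrA ltr_pdivrMr ?mul1r//.
  by rewrite ltr_pdivrMr ?ltr_pwDr//; nra.
have yp : 0 < y by rewrite lt_def yN0.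
have [sx sy] : 0 < Num.sqrt x /\ 0 < Num.sqrt y by rewrite !sqrtr_gt0.
have key (X Y : R) : 0 < X -> 0 < Y ->
    X ^+ 2 <= r * (X / Y / 2 * Y ^+ 2 + (X / Y)^-1 / 2 * X ^+ 2) -> X <= r * Y.
  move=> X0 Y0; rewrite (_ : r * _ = X * (r * Y)); first by rewrite expr2 ler_pM2l.
  by field; rewrite !gt_eqF.
by apply: key => //; rewrite !sqr_sqrtr//; apply: H; exact: divr_gt0.
Qed.

(** * The weighted energy and the scattering form *)

Section scattering.
Context {R : realType} {d : nat} (Om : set 'rV[R]_d) (nu : 'rV[R]_d -> 'rV[R]_d).
Local Notation X := 'rV[R]_d.
Hypothesis Om_open : open Om.
Variables (sigma_s sigma_t : X -> R) (theta : R -> R) (rho : R).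
Hypothesis sigma_t_gt0 : {ae leb d, forall r, Om r -> 0 < sigma_t r}.
Hypothesis sigma_s_bounded : Linf Om sigma_s.
Hypothesis sigma_t_bounded : Linf Om sigma_t.
Hypothesis sigma_st :
  {ae leb d, forall r, Om r -> `|sigma_s r / sigma_t r| <= rho}.
Hypothesis rho_ge0 : 0 <= rho.
Hypothesis theta_meas : measurable_fun (`[-1, 1]%classic : set R) theta.
Hypothesis theta_ge0 : forall x, x \in `[-1, 1] -> 0 <= theta x.
Hypothesis theta_normalized : {ae sphere_measure d, forall s, usphere s ->
  (\int[sphere_measure d]_(s' in usphere) (theta (edot s s'))%:E = 1%:E)%E}.

Let mphase := measurable_phase Om_open.

Lemma ae_volD_fst (P : X -> Prop) : {ae leb d, forall r, P r} ->
  {ae (volD : {measure set (X * X) -> \bar R}), forall z, P z.1}.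
Proof.
move=> [N [mN N0 PN]]; exists (N `*` setT); split.
- exact: measurableX.
- by rewrite /= product_measure1E//= N0 mul0e.
- by move=> z /= Pz; split => //; exact: PN.
Qed.

Lemma Linf_V0_mul f v : Linf Om f -> V0 Om v -> V0 Om (fun z => f z.1 * v z).
Proof.
rewrite /Linf inE => /andP[+ foo]; rewrite inE /= => mf vL.
have [M fM] : exists M : R, {ae leb d, forall r, Om r -> `|f r| <= M}.
  move: foo; rewrite inE /= /finite_norm => foo.
  exists (fine 'N[leb d]_+oo[EFin \o f \_ Om]%E).
  have fin : ('N[leb d]_+oo[EFin \o f \_ Om] \is a fin_num)%E.
    by rewrite ge0_fin_numE ?Lnorm_ge0.
  have := Lnormy_ae (lexx ('N[leb d]_+oo[EFin \o f \_ Om])%E).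
  apply: filterS => r /= + Omr.
  by rewrite -[X in (_ <= X)%E](fineK fin) lee_fin patchE mem_set.
apply: (@L2on_bounded_mul _ _ _ _ _ _ _ M) vL => //.
  rewrite (_ : _ \_ _ = ((f \_ Om) \o fst) \_ (phase Om)).
    apply/(measurable_restrictT _ mphase); apply: measurable_funTS.
    exact: measurableT_comp mf measurable_fst.
  apply/funext => z; rewrite /patch/=; case: ifPn => // /set_mem[Omz _].
  by rewrite mem_set.
by apply: filterS (ae_volD_fst fM) => z zM [Omz _]; exact: zM.
Qed.

Definition energy (v : X * X -> R) : R := ip Om (fun z => sigma_t z.1 * v z) v.

Let edens (v : X * X -> R) := (fun z => sigma_t z.1 * v z * v z) \_ (phase Om).

Let integrable_edens v : V0 Om v -> volD.-integrable setT (EFin \o edens v).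
Proof.
move=> vL; rewrite -restrict_EFin -integrable_mkcond//.
by apply: L2on_mul => //; exact: Linf_V0_mul.
Qed.

(** [sigma_t] is positive only almost everywhere; the absolute value makes the density nonnegative
    everywhere, as the monotonicity lemmas for integrals require. *)
Lemma energyE v : V0 Om v ->
  (energy v)%:E = (\int[volD]_z (`|edens v z|)%:E)%E.
Proof.
move=> vL.
have iv := integrable_edens vL.
rewrite /energy /ip Rintegral_mkcond /Rintegral fineK; last exact: integrable_fin_num.
have mv := measurable_int _ iv.
apply: ae_eq_integral => //.
  by apply/measurable_EFinP; apply: measurableT_comp => //; exact/measurable_EFinP.
apply: filterS (ae_volD_fst sigma_t_gt0) => z tz _.
congr EFin; rewrite ger0_norm// /edens patchE; case: ifPn => // /set_mem[Omz _].
by rewrite -mulrA mulr_ge0 -?expr2 ?sqr_ge0// ltW// tz.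
Qed.

Lemma energy_ge0 v : V0 Om v -> 0 <= energy v.
Proof. by move=> vL; rewrite -lee_fin energyE//; exact: integral_ge0. Qed.

Lemma weighted_normE w : V0 Om (pval w) ->
  weighted_norm Om sigma_t w = (Num.sqrt (energy (pval w)))%:E.
Proof.
move=> wL; rewrite -powR12_sqrt ?energy_ge0// -poweR_EFin energyE//.
have iv := integrable_edens wL.
rewrite /weighted_norm unlock; congr (_ `^ _)%E.
under eq_integral do rewrite /= powR_mulrn// -normrX ger0_norm ?sqr_ge0//.
have mt : measurable_fun setT (sigma_t \_ Om).
  by move: sigma_t_bounded; rewrite /Linf inE => /andP[+ _]; rewrite inE.
apply: ae_eq_integral => //.
- apply/measurable_EFinP; apply: measurable_funX.
  (* Membership in [Linf] gives measurability of [sigma_t] restricted to [Om] only, so the product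
     is rewritten with that restriction. *)
  rewrite (_ : _ \_ _ =
    (fun z => Num.sqrt ((sigma_t \_ Om) z.1)) \* (pval w \_ (phase Om))).
    apply: measurable_funM; last exact: L2on_measurable wL.
    apply: (measurableT_comp (f := @Num.sqrt R)).
      by apply: continuous_measurable_fun; exact: sqrt_continuous.
    exact: measurableT_comp mt measurable_fst.
  apply/funext => z; rewrite /= !patchE.
  case: ifPn => [/set_mem[Omz _]|_]; last by rewrite mulr0.
  by rewrite mem_set.
- apply/measurable_EFinP; apply: measurableT_comp => //.
  by apply/measurable_EFinP; exact: measurable_int iv.
apply: filterS (ae_volD_fst sigma_t_gt0) => z tz _; congr EFin.
rewrite /edens !patchE; case: ifPn => [/set_mem[Omz _]|_]; last first.
  by rewrite expr0n normr0.
have t0 := tz Omz.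
rewrite exprMn sqr_sqrtr ?ltW// -mulrA -expr2 ger0_norm//.
by rewrite mulr_ge0 ?sqr_ge0// ltW.
Qed.

(** Extensions by zero let the kernel estimates run over whole spaces. In [k], [theta] is cut to the
    interval where it is known to be measurable and nonnegative, and both directions to the
    sphere. *)
Let a := sigma_s \_ Om.
Let k (p : X * X) : R :=
  (theta \_ `[-1, 1]) (edot p.1 p.2) * \1_(usphere `*` usphere) p.

Let ma : measurable_fun setT a.
Proof. by move: sigma_s_bounded; rewrite /Linf inE => /andP[+ _]; rewrite inE. Qed.

Let mk : measurable_fun setT k.
Proof.
apply: measurable_funM.
  apply: (measurableT_comp (f := theta \_ `[-1, 1])).
    exact: (measurable_restrictT theta (measurable_itv `[-1, 1])).1 theta_meas.
  by apply: measurable_fun_edot; [exact: measurable_fst|exact: measurable_snd].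
by apply: measurable_indic; apply: measurableX; exact: measurable_usphere.
Qed.

Let kE s t : usphere s -> usphere t -> k (s, t) = theta (edot s t).
Proof.
move=> s1 t1; rewrite /k /= indicE mem_set//= mulr1 patchE mem_set//.
exact: edot_usphere.
Qed.

Let k0 s t : ~ (usphere s /\ usphere t) -> k (s, t) = 0.
Proof. by move=> st; rewrite /k indicE memNset ?mulr0. Qed.

Let k_ge0 p : 0 <= k p.
Proof.
case: p => s t; have [[s1 t1]|st] := pselect (usphere s /\ usphere t).
  by rewrite kE//; apply: theta_ge0; exact: edot_usphere.
by rewrite k0.
Qed.

Let k_sym s t : k (s, t) = k (t, s).
Proof.
have [[s1 t1]|st] := pselect (usphere s /\ usphere t).
  by rewrite !kE// edotC.
by rewrite !k0// => -[? ?]; exact: st.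
Qed.

Let k_le1 : {ae sphere_measure d, forall s,
  (\int[sphere_measure d]_t (k (s, t))%:E <= 1)%E}.
Proof.
apply: filterS theta_normalized => s sP.
have [s1|s1] := pselect (usphere s); last first.
  by rewrite integral0_eq// => t _; rewrite k0// => -[].
rewrite -(sP s1) [leRHS]integral_mkcond le_eqVlt; apply/orP; left; apply/eqP.
apply: eq_integral => t _; rewrite patchE; case: ifPn => [/set_mem t1|t1].
  by rewrite kE.
by rewrite k0// => -[_ /mem_set ut]; rewrite ut in t1.
Qed.

Let m1 : {sigma_finite_measure set X -> \bar R} :=
  sigma_finite_copy (@sigma_finite_leb R d).

Let F (u v : X * X -> R) :=
  kernel_form a k (u \_ (phase Om)) (v \_ (phase Om)).

Let m3 : {measure set ((X * X) * X) -> \bar R} := (volD \x sphere_measure d)%E.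

(** The factor [rho] enters here, through [|sigma_s| <= rho sigma_t] almost everywhere in [Om]. *)
Lemma scatter_energy_le v : V0 Om v ->
  (\int[volD]_z (`|a z.1| * (v \_ (phase Om)) z ^+ 2)%:E <=
   (rho * energy v)%:E)%E.
Proof.
move=> vL; rewrite EFinM energyE//.
have iv := integrable_edens vL.
have mv : measurable_fun setT (fun z => `|edens v z|%:E).
  apply/measurable_EFinP; apply: measurableT_comp => //.
  by apply/measurable_EFinP; exact: measurable_int iv.
rewrite -ge0_integralZl//.
apply: ae_ge0_le_integral => //.
- by move=> z _; rewrite lee_fin mulr_ge0 ?sqr_ge0.
- apply/measurable_EFinP; apply: measurable_funM.
    by apply: measurableT_comp => //; exact: measurableT_comp ma measurable_fst.
  by apply: measurable_funX; exact: L2on_measurable vL.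
- by move=> z _; rewrite -EFinM lee_fin mulr_ge0.
- exact: measurable_funeM.
apply: filterS2 (ae_volD_fst sigma_t_gt0) (ae_volD_fst sigma_st) => z tz stz _.
rewrite -EFinM lee_fin /a /edens.
have [[Omz s1]|Dz] := pselect (phase Om z); last first.
  by rewrite !patchE !(memNset Dz) expr0n mulr0 normr0 mulr0.
rewrite !patchE (mem_set Omz) !(mem_set (conj Omz s1 : phase Om z)).
have := stz Omz; rewrite normrM normfV (gtr0_norm (tz Omz)).
rewrite ler_pdivrMr ?tz// => h.
rewrite -mulrA -expr2 normrM (gtr0_norm (tz Omz)) (ger0_norm (sqr_ge0 _)) mulrA.
by rewrite ler_wpM2r ?sqr_ge0.
Qed.

Lemma integrable_scatter_form u v : V0 Om u -> V0 Om v ->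
  m3.-integrable setT (EFin \o F u v).
Proof.
move=> uL vL.
apply: (@integrable_kernel_form _ _ _ _ _ m1 (sphere_measure d)) => //.
- exact: L2on_measurable uL.
- exact: L2on_measurable vL.
- exact: le_lt_trans (scatter_energy_le uL) (ltry _).
- exact: le_lt_trans (scatter_energy_le vL) (ltry _).
Qed.

Lemma form_sE (u v : @parity R d) : V0 Om (pval u) -> V0 Om (pval v) ->
  form_s Om sigma_s theta u v = \int[m3]_p F (pval u) (pval v) p.
Proof.
move=> uL vL.
have H := @kernel_formE _ _ _ _ _ m1 (sphere_measure d) a k ma mk
  _ _ (L2on_measurable uL) (L2on_measurable vL) (integrable_scatter_form uL vL).
rewrite -[RHS]H /form_s /ip Rintegral_mkcond; apply: eq_Rintegral => -[r s] _.
rewrite !patchE; case: ifPn => [/set_mem[/= Omr s1]|_]; last by rewrite mulr0.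
congr (_ * _); rewrite /scatter /a patchE mem_set//=; congr (_ * _).
rewrite Rintegral_mkcond; apply: eq_Rintegral => t _; rewrite !patchE.
case: ifPn => [/set_mem t1|t1]; first by rewrite kE// mem_set.
by rewrite k0 ?mul0r// => -[_ /mem_set ut]; rewrite ut in t1.
Qed.

(** The inner integral of [scatter] may fail to be additive at some points; the integrable triple
    integral avoids them. *)
Lemma form_s_sub (u v w : @parity R d) :
  V0 Om (pval u) -> V0 Om (pval v) -> V0 Om (pval w) ->
  form_s Om sigma_s theta (parity_sub u v) w =
  form_s Om sigma_s theta u w - form_s Om sigma_s theta v w.
Proof.
move=> uL vL wL.
rewrite !form_sE//; last by rewrite pval_sub; exact: L2onB.
rewrite -RintegralB//; [|exact: integrable_scatter_form..].
have restrictB z : ((pval u \- pval v) \_ (phase Om)) z =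
    (pval u \_ (phase Om)) z - (pval v \_ (phase Om)) z.
  by rewrite !patchE; case: ifP; rewrite // subr0.
by apply: eq_Rintegral => p _; rewrite /F /kernel_form pval_sub restrictB; ring.
Qed.

Lemma form_s_le (u v : @parity R d) (c : R) : 0 < c ->
  V0 Om (pval u) -> V0 Om (pval v) ->
  form_s Om sigma_s theta u v <=
  rho * (c / 2 * energy (pval u) + c^-1 / 2 * energy (pval v)).
Proof.
move=> c0 uL vL; rewrite form_sE//.
have iF := integrable_scatter_form uL vL.
apply: le_trans (ler_norm _) _; apply: le_trans (le_normr_Rintegral _ iF) _ => //.
have iabsF := integrable_abse iF.
rewrite -lee_fin /Rintegral fineK; last exact: integrable_fin_num iabsF.
have := @kernel_form_le _ _ _ _ _ m1 (sphere_measure d) a k ma mk k_ge0 k_sym k_le1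
  _ _ c c0 (L2on_measurable uL) (L2on_measurable vL).
move=> /le_trans; apply.
have c2 : (0 <= (c / 2)%:E)%E by rewrite lee_fin divr_ge0 ?ltW.
have c2' : (0 <= (c^-1 / 2)%:E)%E by rewrite lee_fin divr_ge0 ?invr_ge0 ?ltW.
apply: le_trans (leeD (lee_wpmul2l c2 (scatter_energy_le uL))
  (lee_wpmul2l c2' (scatter_energy_le vL))) _.
by rewrite -!EFinM -EFinD lee_fin mulrDr !(mulrCA rho).
Qed.

(** With the energy of [u] gone, the bound is a constant over [c], and [c] can be taken large. *)
Lemma form_s_le0 (u v : @parity R d) :
  V0 Om (pval u) -> V0 Om (pval v) -> energy (pval u) = 0 ->
  form_s Om sigma_s theta u v <= 0.
Proof.
move=> uL vL u0; rewrite leNgt; apply/negP => s0.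
have K0 : 0 <= rho * energy (pval v) by rewrite mulr_ge0 ?energy_ge0.
have K1 : 0 < rho * energy (pval v) + 1 by rewrite ltr_pwDr.
(* With [K = rho * energy (pval v)] and a positive value [S] of the form, [c = (K + 1) / S] gives
   [S <= S K / (2 (K + 1)) < S]. *)
have := form_s_le (divr_gt0 K1 s0) uL vL; rewrite u0 mulr0 add0r.
set S := form_s _ _ _ _ _ in s0 *.
rewrite (_ : rho * _ =
    S * (rho * energy (pval v) / (2 * (rho * energy (pval v) + 1)))); last first.
  by field; rewrite !gt_eqF.
rewrite -[leLHS]mulr1 ler_pM2l// ler_pdivlMr ?mulr_gt0//.
by move: K0; lra.
Qed.

End scattering.

(** * Contraction of the residuals *)

Theorem lemma1p1 (R : realType) (d : nat) (d_gt0 : (0 < d)%N)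
  (Om : set 'rV[R]_d) (nu : 'rV[R]_d -> 'rV[R]_d)
  (Om_domain : domain Om) (Om_lip : lipschitz_boundary Om)
  (nu_normal : outward_unit_normal Om nu)
  (sigma_a sigma_s sigma_t : 'rV[R]_d -> R) (c0 : R)
  (sigma_s_gt0 : {ae leb d, forall r, Om r -> 0 < sigma_s r})
  (sigma_t_gt0 : {ae leb d, forall r, Om r -> 0 < sigma_t r})
  (sigma_s_bounded : Linf Om sigma_s) (sigma_t_bounded : Linf Om sigma_t)
  (sigma_tE : forall r, Om r -> sigma_t r = sigma_a r + sigma_s r)
  (c0_gt0 : 0 < c0)
  (sigma_a_ge : {ae leb d, forall r, Om r -> c0 <= sigma_a r})
  (rho : \bar R)
  (rhoE : rho = Linf_norm Om (fun r => sigma_s r / sigma_t r))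
  (rho_lt1 : (rho < 1%:E)%E)
  (theta : R -> R)
  (theta_meas : measurable_fun (`[-1, 1]%classic : set R) theta)
  (theta_ge0 : forall x, x \in `[-1, 1] -> 0 <= theta x)
  (theta_normalized : {ae sphere_measure d, forall s, usphere s ->
    (\int[sphere_measure d]_(s' in usphere) (theta (edot s s'))%:E = 1%:E)%E})
  (q qb : 'rV[R]_d * 'rV[R]_d -> R)
  (q_L2 : V0 Om q) (qb_L2 : L2bd Om nu (inflow Om nu) qb)
  (u u_half r r_half : @parity R d)
  (u_W : W Om nu u) (u_half_W : W Om nu u_half)
  (u_halfE : forall v, W Om nu v ->
    form_t Om nu sigma_t u_half v
    = form_s Om sigma_s theta u v + form_l Om nu q qb v)
  (r_residual : is_residual Om nu sigma_s sigma_t theta q qb u r)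
  (r_half_residual :
    is_residual Om nu sigma_s sigma_t theta q qb u_half r_half) :
  (weighted_norm Om sigma_t r_half <= rho * weighted_norm Om sigma_t r)%E.
Proof.
have [Om_open _ _] := Om_domain.
have rho_ge0 : (0 <= rho)%E by rewrite rhoE Lnorm_ge0.
have rho_fin : rho \is a fin_num by rewrite ge0_fin_numE// (lt_trans rho_lt1) ?ltry.
have rhor : (fine rho)%:E = rho by rewrite fineK.
have fine_rho_ge0 : 0 <= fine rho by exact: fine_ge0.
have sigma_st : {ae leb d, forall r, Om r -> `|sigma_s r / sigma_t r| <= fine rho}.
  have /Lnormy_ae : (Linf_norm Om (fun r => sigma_s r / sigma_t r)%R <= rho)%E.
    by rewrite rhoE.
  by apply: filterS => x /= + Omx; rewrite -lee_fin rhor patchE mem_set.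
have V0_sigma_t v : V0 Om v -> V0 Om (fun z => sigma_t z.1 * v z).
  exact: Linf_V0_mul.
have [[r_W rE] [rh_W rhE]] := (r_residual, r_half_residual).
have [[[uR uhR] rR] rhR] := (W_regular u_W, W_regular u_half_W,
  W_regular r_W, W_regular rh_W).
pose D := parity_sub u_half u.
have DR : regular_parity Om nu D by exact: regular_parity_sub.
pose E := parity_sub D r.
have ER : regular_parity Om nu E by exact: regular_parity_sub.
(* [E] is only tested against [u_half], [u] and [r], so that [W] need not be
   known to be a subspace. *)
have tE0 v : W Om nu v -> form_t Om nu sigma_t E v = 0.
  move=> vW; have vR := W_regular vW.
  (* Both [t(D, v)] and [t(r, v)] equal [s(u, v) + l(v) - t(u, v)]. *)
  by rewrite !form_t_subl// u_halfE// rE//; ring.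
have tEE : form_t Om nu sigma_t E E = 0.
  by rewrite form_t_subr// form_t_subr// !tE0//; ring.
have [EL DL] := (regular_pval ER, regular_pval DR).
have [rL rhL] := (regular_pval rR, regular_pval rhR).
have energyE0 : energy Om sigma_t (pval E) = 0.
  by apply/eqP; rewrite eq_le energy_ge0// -tEE form_t_ge.
rewrite !weighted_normE// -rhor -EFinM lee_fin.
apply: sqrt_le_of_young; rewrite ?energy_ge0// => c c_gt0.
apply: (le_trans (form_t_ge Om nu sigma_t r_half)).
(* The source terms cancel, leaving [s(u_half, r_half) - s(u, r_half)]. *)
rewrite rhE// u_halfE//.
(* [E] has zero energy but is not literally zero, so [D] is exchanged for [r] inside [s] by this
   inequality. *)
have sE := form_s_le0 Om_open sigma_t_gt0 sigma_s_bounded sigma_t_bounded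
  sigma_st fine_rho_ge0 theta_meas theta_ge0 theta_normalized EL rhL energyE0.
have sr := form_s_le Om_open sigma_t_gt0 sigma_s_bounded sigma_t_bounded
  sigma_st fine_rho_ge0 theta_meas theta_ge0 theta_normalized c_gt0 rL rhL.
have sB (x y : parity) := @form_s_sub _ _ _ Om_open _ _ _ _ sigma_t_gt0
  sigma_s_bounded sigma_t_bounded sigma_st fine_rho_ge0 theta_meas theta_ge0
  theta_normalized x y r_half.
have sED := sB D r DL rL rhL.
have sD := sB u_half u (regular_pval uhR) (regular_pval uR) rhL.
(* [s(D, r_half) = s(E, r_half) + s(r, r_half) <= s(r, r_half)]. *)
by apply: le_trans sr; move: sE; rewrite sED sD; lra.
Qed.
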